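(* Let $R \cong R_1 \times R_2 \times \cdots \times R_n$ $(n \ge 2)$ be a non-local commutative Artinian ring with unity, where each $R_i$ is a local ring with maximal ideal $\mathcal{M}_i$. Then the prime ideal sum graph $\mathrm{PIS}(R)$ is a line graph if and only if one of the following holds: (i) $R \cong F_1 \times F_2 \times F_3$ for some fields $F_1, F_2, F_3$; (ii) $R \cong F_1 \times F_2$ for some fields $F_1, F_2$; (iii) $R \cong S \times F$ for some field $F$ and some local principal ideal ring $S$ whose maximal ideal $\mathfrak{n}$ satisfies $\eta(\mathfrak{n}) = 2$.
   Context: The prime ideal sum graph $\mathrm{PIS}(R)$ of a commutative ring $R$ with unity is the simple undirected graph whose vertex set is the set of all nonzero proper ideals of $R$, where two distinct vertices $I, J$ are adjacent if and only if $I + J$ is a prime ideal of $R$. A local ring is a ring with a unique maximal ideal; fields are included, with maximal ideal $\langle 0\rangle$. The nilpotent index $\eta(I)$ of an ideal $I$ is the smallest positive integer $n$ such that $I^n = 0$. The line graph $L(\Gamma)$ of a (simple) graph $\Gamma$ has as vertices the edges of $\Gamma$, two distinct vertices being adjacent if the corresponding edges share an endpoint in $\Gamma$. A graph ''is a line graph'' if it is isomorphic to $L(\Gamma)$ for some graph $\Gamma$. *)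

(* Defs.v *)
From HB Require Import structures.
From mathcomp Require Import all_boot all_algebra.
From mathcomp Require Import boolp classical_sets.

Set Implicit Arguments.
Unset Strict Implicit.
Unset Printing Implicit Defensive.

Import GRing.Theory.
Local Open Scope classical_set_scope.
Local Open Scope ring_scope.

(* Rings are comPzRingType, so the zero ring is not excluded a priori; a local
   ring is automatically nonzero, since the zero ring has no maximal ideal. *)

Definition ring_iso (R S : pzRingType) : Prop :=
  exists f : {rmorphism R -> S}, bijective f.

Section ProductRing.
Variables (n : nat) (R_ : 'I_n -> comPzRingType).

(* The library only has binary products of rings and powers {ffun I -> R} of a
   single ring. *)
Definition prod_ring : Type := {dffun forall i : 'I_n, R_ i}.

HB.instance Definition _ := Choice.on prod_ring.

Implicit Types f g : prod_ring.

Definition prod_zero : prod_ring := [ffun i : 'I_n => (0 : R_ i)].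
Definition prod_one : prod_ring := [ffun i : 'I_n => (1 : R_ i)].
Definition prod_opp f : prod_ring := [ffun i : 'I_n => - (f i : R_ i)].
Definition prod_add f g : prod_ring := [ffun i : 'I_n => (f i + g i : R_ i)].
Definition prod_mul f g : prod_ring := [ffun i : 'I_n => (f i * g i : R_ i)].

Fact prod_addA : associative prod_add.
Proof. by move=> f g h; apply/ffunP=> i; rewrite !ffunE addrA. Qed.
Fact prod_addC : commutative prod_add.
Proof. by move=> f g; apply/ffunP=> i; rewrite !ffunE addrC. Qed.
Fact prod_add0 : left_id prod_zero prod_add.
Proof. by move=> f; apply/ffunP=> i; rewrite !ffunE add0r. Qed.
Fact prod_addN : left_inverse prod_zero prod_opp prod_add.
Proof. by move=> f; apply/ffunP=> i; rewrite !ffunE addNr. Qed.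

HB.instance Definition _ := GRing.isZmodule.Build prod_ring
  prod_addA prod_addC prod_add0 prod_addN.

Fact prod_mulA : associative prod_mul.
Proof. by move=> f g h; apply/ffunP=> i; rewrite !ffunE mulrA. Qed.
Fact prod_mulC : commutative prod_mul.
Proof. by move=> f g; apply/ffunP=> i; rewrite !ffunE mulrC. Qed.
Fact prod_mul1 : left_id prod_one prod_mul.
Proof. by move=> f; apply/ffunP=> i; rewrite !ffunE mul1r. Qed.
Fact prod_mulD : left_distributive prod_mul (@GRing.add prod_ring).
Proof. by move=> f g h; apply/ffunP=> i; rewrite !ffunE mulrDl. Qed.

HB.instance Definition _ := GRing.Zmodule_isComPzRing.Build prod_ring
  prod_mulA prod_mulC prod_mul1 prod_mulD.

End ProductRing.

Section Ideals.
Variable R : comPzRingType.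
Implicit Types I J P M : set R.

(* idealr_closed of ring_quotient only covers proper ideals given by boolean
   predicates; here the whole ring is an ideal and membership is in Prop. *)
Definition is_ideal I : Prop :=
  [/\ I 0,
      forall x y, I x -> I y -> I (x + y) &
      forall a x, I x -> I (a * x)].

Definition ideal_sum I J : set R := [set x + y | x in I & y in J].

Definition ideal_prod I J : set R :=
  [set x | exists (k : nat) (a b : 'I_k -> R),
     (forall i, I (a i)) /\ (forall i, J (b i)) /\ x = \sum_(i < k) a i * b i].

Fixpoint ideal_pow I (k : nat) : set R :=
  if k is k'.+1 then ideal_prod I (ideal_pow I k') else setT.

Definition nilpotent_index I (k : nat) : Prop :=
  [/\ (0 < k)%N,
      ideal_pow I k = [set 0] &
      forall m : nat, (0 < m)%N -> ideal_pow I m = [set 0] -> (k <= m)%N].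

Definition prime_ideal P : Prop :=
  [/\ is_ideal P,
      P <> setT &
      forall a b, P (a * b) -> P a \/ P b].

Definition maximal_ideal M : Prop :=
  [/\ is_ideal M,
      M <> setT &
      forall J, is_ideal J -> M `<=` J -> J = M \/ J = setT].

Definition local_with_maximal M : Prop := unique maximal_ideal M.

Definition local_ring : Prop := exists M, local_with_maximal M.

Definition principal_ideal_ring : Prop :=
  forall I, is_ideal I -> exists a : R, I = [set x * a | x in setT].

Definition artinian : Prop :=
  forall I_ : nat -> set R,
    (forall k, is_ideal (I_ k)) ->
    (forall k, I_ k.+1 `<=` I_ k) ->
    exists N : nat, forall k, (N <= k)%N -> I_ k = I_ N.

End Ideals.

Arguments local_with_maximal : clear implicits.
Arguments local_ring : clear implicits.
Arguments principal_ideal_ring : clear implicits.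
Arguments artinian : clear implicits.

(* Possibly infinite: an Artinian ring may have infinitely many ideals. *)
Record sgraph : Type := SGraph {
  vertex :> Type;
  adj : vertex -> vertex -> Prop;
  adj_sym : forall x y, adj x y -> adj y x;
  adj_irrefl : forall x, ~ adj x x }.

Definition graph_iso (G H : sgraph) : Prop :=
  exists f : G -> H,
    bijective f /\ forall x y, adj x y <-> adj (f x) (f y).

Section LineGraph.
Variable G : sgraph.

(* Edges are unordered pairs, represented as two-element sets of vertices. *)
Definition is_edge (e : set G) : Prop :=
  exists x y : G, adj x y /\ e = [set x; y].

Definition edge : Type := {e : set G | is_edge e}.

Definition edge_adj (e f : edge) : Prop :=
  e <> f /\ sval e `&` sval f !=set0.

Fact edge_adj_sym e f : edge_adj e f -> edge_adj f e.
Proof. by case=> nef ef; split; [exact/nesym | rewrite setIC]. Qed.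

Fact edge_adj_irrefl e : ~ edge_adj e e.
Proof. by case. Qed.

Definition line_graph : sgraph := SGraph edge_adj_sym edge_adj_irrefl.

End LineGraph.

Definition is_line_graph (G : sgraph) : Prop :=
  exists H : sgraph, graph_iso G (line_graph H).

Section PrimeIdealSumGraph.
Variable R : comPzRingType.

Definition pis_vertex : Type :=
  {I : set R | [/\ is_ideal I, I <> [set 0] & I <> setT]}.

Definition pis_adj (I J : pis_vertex) : Prop :=
  I <> J /\ prime_ideal (ideal_sum (sval I) (sval J)).

Fact ideal_sumC (I J : set R) : ideal_sum I J = ideal_sum J I.
Proof.
by apply/seteqP; split=> _ [x Ix [y Jy <-]]; exists y => //; exists x;
  rewrite // addrC.
Qed.

Fact pis_adj_sym I J : pis_adj I J -> pis_adj J I.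
Proof. by case=> nIJ pIJ; split; [exact/nesym | rewrite ideal_sumC]. Qed.

Fact pis_adj_irrefl I : ~ pis_adj I I.
Proof. by case. Qed.

Definition PIS : sgraph := SGraph pis_adj_sym pis_adj_irrefl.

End PrimeIdealSumGraph.

(* Main.v *)
Require Import Defs.
From HB Require Import structures.
From mathcomp Require Import all_boot all_algebra.
From mathcomp Require Import boolp classical_sets.
From mathcomp Require Import ring.

(* A line graph has no induced claw. If M1, M2, M3 are distinct maximal ideals
   with nonzero intersection C, then C is the centre of a claw with leaves M1,
   M2, M3; this leaves three fields, or two local factors A and B. For n = 2 let
   M and N be the maximal ideals of A and B. If both are nonzero, M x B is the
   centre of a claw with leaves M x 0, 0 x N and M x N. If B is a field and
   0 < I < M, then M x 0 is the centre of a claw with leaves A x 0, 0 x B and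
   I x B; the sum I x B is not prime because primes of an Artinian ring are
   maximal. Hence M is zero or minimal, and a minimal M is principal of square 0.
   Conversely, in the three listed cases the graph is an induced subgraph of the
   3-sun, the line graph of a triangle with a pendant edge at each vertex. *)

Set Implicit Arguments.
Unset Strict Implicit.
Unset Printing Implicit Defensive.

Import GRing.Theory.
Local Open Scope classical_set_scope.
Local Open Scope ring_scope.

(** * Line graphs: a construction criterion and claw-freeness *)

Lemma inj_surj_bij (A B : Type) (f : A -> B) :
  injective f -> (forall y, exists x, f x = y) -> bijective f.
Proof.
move=> injf surjf; have [g fg] := choice surjf.
by exists g => // x; apply: injf.
Qed.

Lemma is_line_graph_iso (G H : sgraph) :
  graph_iso G H -> is_line_graph H -> is_line_graph G.
Proof.
move=> [f [bijf adjf]] [K [g [bijg adjg]]]; exists K, (g \o f).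
split; first exact: bij_comp.
by move=> x y; apply: (iff_trans (adjf x y)); exact: adjg.
Qed.

(** The root graph lives on [V] and its edges are exactly the sets [[set s v; t v]], so sending [v]
    to its edge is onto by construction. The hypotheses supply loop-freeness, injectivity and the
    adjacency condition. *)
Lemma is_line_graph_endpoints (G : sgraph) (V : Type) (s t : G -> V) :
    (forall v, s v <> t v) ->
    (forall u v, [set s u; t u] = [set s v; t v] -> u = v) ->
    (forall u v, adj u v <->
       u <> v /\ [set s u; t u] `&` [set s v; t v] !=set0) ->
  is_line_graph G.
Proof.
move=> st_neq st_inj st_adj.
pose adjH (x y : V) := x <> y /\ exists v, [set s v; t v] = [set x; y].
have symH x y : adjH x y -> adjH y x.
  by case=> /nesym nxy [v ev]; split=> //; exists v; rewrite ev setUC.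
have irrH x : ~ adjH x x by case.
pose H := SGraph symH irrH.
have edgeH v : @is_edge H [set s v; t v].
  by exists (s v), (t v); split=> //; split; [exact: st_neq | exists v].
pose f v : line_graph H := exist _ _ (edgeH v).
have injf : injective f by move=> u v [/st_inj].
exists H, f; split.
  apply: inj_surj_bij => // -[e [x [y [[nxy [v ev]] ee]]]].
  by exists v; apply: eq_exist; rewrite ev ee.
move=> u v; rewrite st_adj; split=> -[nuv uv]; split=> //.
  by move=> /injf.
by move=> uv'; apply: nuv; rewrite uv'.
Qed.

(** Pigeonhole: the edge [c] has two ends and each of the three leaves contains one of them, so two
    leaves share an end. *)
Lemma line_graph_claw_free (G : sgraph) (c l1 l2 l3 : G) :
    is_line_graph G -> adj c l1 -> adj c l2 -> adj c l3 ->
    l1 <> l2 -> l1 <> l3 -> l2 <> l3 ->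
  [\/ adj l1 l2, adj l1 l3 | adj l2 l3].
Proof.
move=> [H [f [/bij_inj injf adjf]]] /adjf[_ c1] /adjf[_ c2] /adjf[_ c3].
move=> n12 n13 n23.
have meet (u v : G) x : u <> v -> sval (f u) x -> sval (f v) x -> adj u v.
  by move=> nuv ux vx; apply/adjf; split; [move=> /injf | exists x].
case: (f c) c1 c2 c3 => e [x [y [_ E]]] /=; rewrite {e}E.
move=> [_ [[->|->] h1]] [_ [[->|->] h2]] [_ [[->|->] h3]];
  by [apply: Or31; apply: meet h1 h2 | apply: Or32; apply: meet h1 h3
     | apply: Or33; apply: meet h2 h3].
Qed.

(** * Ideals of a commutative ring: sums, maximal and prime ideals *)

Section IdealTheory.
Variable R : comPzRingType.
Implicit Types (I J P M : set R) (x y r : R).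

Lemma ideal0 I : is_ideal I -> I 0. Proof. by case. Qed.

Lemma idealD I x y : is_ideal I -> I x -> I y -> I (x + y).
Proof. by case=> _ + _; apply. Qed.

Lemma idealMl I r x : is_ideal I -> I x -> I (r * x).
Proof. by case=> _ _; apply. Qed.

Lemma idealMr I r x : is_ideal I -> I x -> I (x * r).
Proof. by rewrite mulrC; apply: idealMl. Qed.

Lemma ideal_eqT I : is_ideal I -> I 1 -> I = setT.
Proof.
by move=> iI I1; apply/seteqP; split=> // x _; rewrite -[x]mulr1; apply: idealMl.
Qed.

Lemma ideal_neqT I : is_ideal I -> I <> setT <-> ~ I 1.
Proof.
by move=> iI; split=> [nI /(ideal_eqT iI) // | nI1 IT]; apply: nI1; rewrite IT.
Qed.

Lemma ideal_neq0P I : is_ideal I -> I <> [set 0] <-> exists2 x, I x & x <> 0.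
Proof.
move=> iI; split=> [nI | [x Ix nx] I0]; last by rewrite I0 in Ix.
apply: contrapT => h; apply: nI; apply/seteqP; split=> x; last first.
  by move=> ->; apply: ideal0.
by move=> Ix; apply: contrapT => nx; apply: h; exists x.
Qed.

Lemma ideal_set0 : is_ideal [set (0 : R)].
Proof.
by split=> // [x y -> ->|r x ->]; rewrite /= ?addr0 ?mulr0.
Qed.

Lemma ideal_setT : @is_ideal R setT. Proof. by []. Qed.

Lemma ideal_setI I J : is_ideal I -> is_ideal J -> is_ideal (I `&` J).
Proof.
move=> iI iJ; split; first by split; apply: ideal0.
  by move=> x y [Ix Jx] [Iy Jy]; split; apply: idealD.
by move=> r x [Ix Jx]; split; apply: idealMl.
Qed.

Lemma ideal_principal (a : R) : is_ideal [set x * a | x in [set: R]].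
Proof.
split; first by exists 0 => //; rewrite mul0r.
  by move=> _ _ [x _ <-] [y _ <-]; exists (x + y) => //; rewrite mulrDl.
by move=> r _ [x _ <-]; exists (r * x) => //; rewrite mulrA.
Qed.

Lemma ideal_ideal_sum I J : is_ideal I -> is_ideal J -> is_ideal (ideal_sum I J).
Proof.
move=> iI iJ; split.
- by exists 0; [exact: ideal0 | exists 0; [exact: ideal0 | rewrite addr0]].
- move=> _ _ [x Ix [y Jy <-]] [x' Ix' [y' Jy' <-]].
  exists (x + x'); first exact: idealD.
  by exists (y + y'); [exact: idealD | rewrite addrACA].
- move=> r _ [x Ix [y Jy <-]]; exists (r * x); first exact: idealMl.
  by exists (r * y); [exact: idealMl | rewrite mulrDr].
Qed.

Lemma ideal_sum_subl I J : is_ideal J -> I `<=` ideal_sum I J.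
Proof. by move=> iJ x Ix; exists x => //; exists 0; [exact: ideal0 | rewrite addr0]. Qed.

Lemma ideal_sum_subr I J : is_ideal I -> J `<=` ideal_sum I J.
Proof. by rewrite ideal_sumC; apply: ideal_sum_subl. Qed.

Lemma ideal_sum_absorbr I J : is_ideal I -> is_ideal J -> I `<=` J ->
  ideal_sum I J = J.
Proof.
move=> iI iJ IJ; apply/seteqP; split; last exact: ideal_sum_subr.
by move=> _ [x /IJ Jx [y Jy <-]]; apply: idealD.
Qed.

Lemma ideal_sum_absorbl I J : is_ideal I -> is_ideal J -> I `<=` J ->
  ideal_sum J I = J.
Proof. by rewrite ideal_sumC; apply: ideal_sum_absorbr. Qed.

Lemma mem_ideal_prod I J x y : I x -> J y -> ideal_prod I J (x * y).
Proof. by move=> Ix Jy; exists 1%N, (fun=> x), (fun=> y); rewrite big_ord1. Qed.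

(** Elementwise form of the fact that R / M is a field: for x outside M, the ideal M + Rx is
    everything, so 1 = m + r x. It transfers easily to preimages and gives explicit inverses modulo
    M. *)
Lemma maximal_idealP M : maximal_ideal M <->
  [/\ is_ideal M, ~ M 1 & forall x, ~ M x -> exists r, M (1 - r * x)].
Proof.
split=> [[iM nMT maxM] | [iM nM1 invM]]; last first.
  split=> //; first exact/ideal_neqT.
  move=> J iJ MJ; have [JM|nJM] := EM (J `<=` M).
    by left; apply/seteqP.
  right; apply: ideal_eqT => //.
  have [x Jx nMx] : exists2 x, J x & ~ M x.
    by apply: contrapT => h; apply: nJM => x Jx; apply: contrapT => ?; apply: h; exists x.
  have [r /MJ Jr] := invM x nMx.
  by rewrite -(subrK (r * x) 1); apply: idealD => //; apply: idealMl.
split=> //; first exact/ideal_neqT.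
move=> x nMx; have iX := ideal_principal x.
have [E|E] := maxM _ (ideal_ideal_sum iM iX) (ideal_sum_subl iX).
  exfalso; apply: nMx; rewrite -E; apply: ideal_sum_subr => //.
  by exists 1 => //; rewrite mul1r.
have : ideal_sum M [set x0 * x | x0 in setT] 1 by rewrite E.
by move=> [m Mm [_ [r _ <-]]] <-; exists r; rewrite addrK.
Qed.

Lemma maximal_prime M : maximal_ideal M -> prime_ideal M.
Proof.
move=> /maximal_idealP[iM nM1 invM]; split=> //; first exact/ideal_neqT.
move=> a b Mab; have [Ma|nMa] := EM (M a); [by left|right].
have [r Mr] := invM a nMa.
have -> : b = b * (1 - r * a) + r * (a * b) by ring.
by apply: idealD => //; apply: idealMl.
Qed.

(** For x outside P the chain of ideals generated by the powers of x stabilises, so x^N = r x^(N+1)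
    and x^N (1 - r x) = 0 lies in P. No power of x is in P, hence 1 - r x is. *)
Lemma artinian_prime_maximal P : artinian R -> prime_ideal P -> maximal_ideal P.
Proof.
move=> artR [iP nPT primeP]; apply/maximal_idealP; split=> //.
  exact/ideal_neqT.
move=> x nPx; pose X k := [set y * x ^+ k | y in [set: R]].
have [|k _ [y _ <-]|N EN] := artR X.
- by move=> k; apply: ideal_principal.
- by exists (y * x) => //; rewrite -mulrA -exprS.
have : X N.+1 (x ^+ N).
  by rewrite EN //; exists 1 => //; rewrite mul1r.
move=> [r _ rE]; exists r.
have nPxN k : ~ P (x ^+ k).
  elim: k => [|k IHk]; first by rewrite expr0; apply/ideal_neqT.
  by rewrite exprS => /primeP[].
have : P (x ^+ N * (1 - r * x)).
  have -> : x ^+ N * (1 - r * x) = x ^+ N - r * (x * x ^+ N) by ring.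
  by rewrite -exprS rE subrr; apply: ideal0.
by case/primeP => // /nPxN.
Qed.

(** * Claws in the prime ideal sum graph *)

Lemma pis_claw (C L1 L2 L3 : set R) :
    [/\ is_ideal C, C <> [set 0] & ~ C 1] ->
    [/\ is_ideal L1, L1 <> [set 0] & ~ L1 1] ->
    [/\ is_ideal L2, L2 <> [set 0] & ~ L2 1] ->
    [/\ is_ideal L3, L3 <> [set 0] & ~ L3 1] ->
    [/\ C <> L1, C <> L2 & C <> L3] -> [/\ L1 <> L2, L1 <> L3 & L2 <> L3] ->
    [/\ prime_ideal (ideal_sum C L1), prime_ideal (ideal_sum C L2)
      & prime_ideal (ideal_sum C L3)] ->
    [/\ ~ prime_ideal (ideal_sum L1 L2), ~ prime_ideal (ideal_sum L1 L3)
      & ~ prime_ideal (ideal_sum L2 L3)] ->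
  ~ is_line_graph (PIS R).
Proof.
have vertexP I : [/\ is_ideal I, I <> [set 0] & ~ I 1] ->
    [/\ is_ideal I, I <> [set 0] & I <> setT].
  by case=> iI nI0 nI1; split=> //; apply/ideal_neqT.
move=> /vertexP vC /vertexP v1 /vertexP v2 /vertexP v3.
move=> [nC1 nC2 nC3] [n12 n13 n23] [pC1 pC2 pC3] [p12 p13 p23] lG.
have /= := @line_graph_claw_free (PIS R) (exist _ _ vC) (exist _ _ v1)
  (exist _ _ v2) (exist _ _ v3) lG.
case; solve [by split=> //; case | by case | by case=> /=].
Qed.

(** Each Mi absorbs the intersection C, so C + Mi = Mi is prime, whereas two distinct maximal ideals
    add up to the whole ring. *)
Lemma pis_claw_three_maximal (M1 M2 M3 : set R) :
    maximal_ideal M1 -> maximal_ideal M2 -> maximal_ideal M3 ->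
    [/\ M1 <> M2, M1 <> M3 & M2 <> M3] ->
  is_line_graph (PIS R) -> M1 `&` M2 `&` M3 = [set 0].
Proof.
move=> m1 m2 m3 [n12 n13 n23] lG; apply: contrapT => nC0; move: lG.
have [[i1 t1 _] [i2 t2 _] [i3 t3 _]] := And3 m1 m2 m3.
have iC : is_ideal (M1 `&` M2 `&` M3) by do 2 apply: ideal_setI => //.
have [x [[x1 x2] x3] nx] := (ideal_neq0P iC).1 nC0.
have nsub M M' : maximal_ideal M -> maximal_ideal M' -> M <> M' -> ~ M `<=` M'.
  move=> [iM _ maxM] [iM' tM' _] nMM' MM'.
  by have [|] := maxM M' iM' MM' => E; [apply: nMM' | apply: tM'].
have sumT M M' : maximal_ideal M -> maximal_ideal M' -> M <> M' ->
    ~ prime_ideal (ideal_sum M M').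
  move=> mM mM' nMM' [_ nT _]; have [iM _ maxM] := mM; have [iM' _ maxM'] := mM'.
  have [E|//] := maxM _ (ideal_ideal_sum iM iM') (ideal_sum_subl iM').
  by apply: (nsub M' M mM' mM); [exact/nesym | rewrite -E; apply: ideal_sum_subr].
have vx M : maximal_ideal M -> M x -> [/\ is_ideal M, M <> [set 0] & ~ M 1].
  by move=> /maximal_idealP[iM nM1 _] Mx; split=> //; apply/ideal_neq0P => //; exists x.
apply: (@pis_claw (M1 `&` M2 `&` M3) M1 M2 M3); try exact: vx.
- by split=> // -[[M11 _] _]; apply: (ideal_neqT i1).1 M11.
(* If C were one of the three, that maximal ideal would lie inside another one. *)
- split=> E.
  + by apply: (nsub _ _ m1 m2 n12); rewrite -E => y [[]].
  + by apply: (nsub _ _ m2 m1 (nesym n12)); rewrite -E => y [[]].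
  + by apply: (nsub _ _ m3 m1 (nesym n13)); rewrite -E => y [[]].
- by [].
- by split; rewrite ideal_sum_absorbr //; try exact: maximal_prime; move=> y [[]].
- by split; apply: sumT.
Qed.

End IdealTheory.

(** * Ring isomorphisms *)

Lemma ring_isoI (R S : pzRingType) (f : R -> S) :
  {morph f : x y / x - y} -> {morph f : x y / x * y} -> f 1 = 1 ->
  bijective f -> ring_iso R S.
Proof.
move=> fB fM f1 bijf.
pose zM := GRing.isZmodMorphism.Build R S f fB.
pose mM := GRing.isMonoidMorphism.Build R S f (f1, fM).
pose F : {rmorphism R -> S} := HB.pack f zM mM.
by exists F.
Qed.

Lemma bij_rmorphism_inv (R S : pzRingType) (f : {rmorphism R -> S}) :
  bijective f -> exists g : {rmorphism S -> R}, cancel f g /\ cancel g f.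
Proof.
move=> [g fK gK].
pose zM := GRing.isZmodMorphism.Build S R g (can2_zmod_morphism fK gK).
pose mM := GRing.isMonoidMorphism.Build S R g (can2_monoid_morphism fK gK).
by exists (HB.pack_for {rmorphism S -> R} g zM mM).
Qed.

Lemma ring_iso_sym (R S : pzRingType) : ring_iso R S -> ring_iso S R.
Proof. by move=> [f /bij_rmorphism_inv[g [fK gK]]]; exists g, f. Qed.

Lemma ring_iso_trans (R S T : pzRingType) :
  ring_iso R S -> ring_iso S T -> ring_iso R T.
Proof. by move=> [f bf] [g bg]; exists (g \o f); apply: bij_comp. Qed.

Lemma ring_iso_pair (A A' B B' : pzRingType) :
  ring_iso A A' -> ring_iso B B' -> ring_iso (A * B)%type (A' * B')%type.
Proof.
move=> [f [f' fK f'K]] [g [g' gK g'K]].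
apply: (@ring_isoI _ _ (fun x => (f x.1, g x.2))).
- by move=> x y /=; rewrite !rmorphB.
- by move=> x y /=; rewrite !rmorphM.
- by rewrite /= !rmorph1.
- by exists (fun x => (f' x.1, g' x.2)) => -[x y] /=; rewrite ?fK ?gK ?f'K ?g'K.
Qed.

Lemma ring_iso_swap (A B : pzRingType) : ring_iso (A * B)%type (B * A)%type.
Proof.
apply: (@ring_isoI _ _ (fun x => (x.2, x.1))) => //.
by exists (fun x => (x.2, x.1)) => -[].
Qed.

(** * Preimages of ideals and invariance of the graph under isomorphism *)

Section Preimage.
Variables (R S : comPzRingType) (f : {rmorphism R -> S}).
Implicit Types I J M P : set S.

Lemma ideal_preimage J : is_ideal J -> is_ideal (f @^-1` J).
Proof.
move=> iJ; split; first by rewrite /preimage /= rmorph0; apply: ideal0.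
  by move=> x y Jx Jy; rewrite /preimage /= rmorphD; apply: idealD.
by move=> r x Jx; rewrite /preimage /= rmorphM; apply: idealMl.
Qed.

Lemma prime_preimage P : prime_ideal P -> prime_ideal (f @^-1` P).
Proof.
move=> [iP /(ideal_neqT iP) nP1 primeP]; have ifP := ideal_preimage iP.
split=> //; first by apply/(ideal_neqT ifP); rewrite /preimage /= rmorph1.
by move=> a b; rewrite /preimage /= rmorphM => /primeP.
Qed.

Hypothesis surjf : forall y, exists x, f x = y.

Lemma preimage_surj_inj I J : f @^-1` I = f @^-1` J -> I = J.
Proof.
move=> E; apply/seteqP; split=> y; have [x <-] := surjf y => fx.
  by have : (f @^-1` J) x by rewrite -E.
by have : (f @^-1` I) x by rewrite E.
Qed.

Lemma maximal_preimage M : maximal_ideal M -> maximal_ideal (f @^-1` M).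
Proof.
move=> /maximal_idealP[iM nM1 invM]; apply/maximal_idealP; split.
- exact: ideal_preimage.
- by rewrite /preimage /= rmorph1.
- move=> x nMx; have [s] := invM (f x) nMx; have [r <-] := surjf s => Mr.
  by exists r; rewrite /preimage /= rmorphB rmorph1 rmorphM.
Qed.

Lemma artinian_surj : artinian R -> artinian S.
Proof.
move=> artR J_ iJ decJ; have [||N EN] := artR (fun k => f @^-1` J_ k).
- by move=> k; apply: ideal_preimage.
- by move=> k x; apply: decJ.
- by exists N => k /EN; apply: preimage_surj_inj.
Qed.

End Preimage.

Lemma artinian_iso (R S : comPzRingType) : ring_iso R S -> artinian R -> artinian S.
Proof.
move=> [f [g _ gK]]; apply: (@artinian_surj _ _ f) => y.
by exists (g y).
Qed.

Lemma ideal_sum_preimage (R S : comPzRingType) (f : {rmorphism R -> S}) (I J : set S) :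
  bijective f -> ideal_sum (f @^-1` I) (f @^-1` J) = f @^-1` ideal_sum I J.
Proof.
move=> [g fK gK]; apply/seteqP; split=> x.
  move=> [u Iu [v Jv <-]]; exists (f u) => //; exists (f v) => //.
  by rewrite rmorphD.
move=> [u Iu [v Jv uv]]; exists (g u); first by rewrite /preimage /= gK.
exists (g v); first by rewrite /preimage /= gK.
by apply: (can_inj fK); rewrite rmorphD !gK.
Qed.

(** Taking preimages is contravariant, hence the swapped order. Preimage along the inverse undoes
    preimage along [f], bijectivity makes preimages commute with sums, and primality passes both
    ways. *)
Lemma PIS_iso (R S : comPzRingType) : ring_iso R S -> graph_iso (PIS S) (PIS R).
Proof.
move=> [f bijf]; have [g [fK gK]] := bij_rmorphism_inv bijf.
have bijg : bijective g by exists f.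
have pre_vertex (A B : comPzRingType) (h : {rmorphism A -> B}) (I : set B) :
    bijective h -> [/\ is_ideal I, I <> [set 0] & I <> setT] ->
    [/\ is_ideal (h @^-1` I), h @^-1` I <> [set 0] & h @^-1` I <> setT].
  move=> [k hK kK] [iI nI0 nIT].
  have surjh y : exists x, h x = y by exists (k y).
  split; first exact: ideal_preimage.
    move=> E; apply: nI0; apply: (preimage_surj_inj surjh); rewrite E.
    apply/seteqP; split=> x; first by move=> ->; rewrite /preimage /= rmorph0.
    by rewrite /preimage /= => hx; apply: (can_inj hK); rewrite hx rmorph0.
  by move=> E; apply: nIT; apply: (preimage_surj_inj surjh); rewrite E preimage_setT.
have fgE (I : set R) : f @^-1` (g @^-1` I) = I.
  by apply/seteqP; split=> x; rewrite /preimage /= fK.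
have gfE (J : set S) : g @^-1` (f @^-1` J) = J.
  by apply/seteqP; split=> x; rewrite /preimage /= gK.
pose F (v : PIS S) : PIS R := exist _ _ (pre_vertex _ _ f _ bijf (svalP v)).
pose G (v : PIS R) : PIS S := exist _ _ (pre_vertex _ _ g _ bijg (svalP v)).
have FK : cancel F G by move=> [J vJ]; apply: eq_exist; apply: gfE.
exists F; split; first by exists G => // -[I vI]; apply: eq_exist; apply: fgE.
move=> u v; rewrite /= /pis_adj /= ideal_sum_preimage //.
split=> -[nuv p]; split.
- by move=> /(can_inj FK).
- exact: prime_preimage.
- by move=> uv; apply: nuv; rewrite uv.
- by rewrite -[ideal_sum _ _]gfE; apply: prime_preimage.
Qed.

Lemma PIS_is_line_graph_iso (R S : comPzRingType) :
  ring_iso R S -> is_line_graph (PIS R) <-> is_line_graph (PIS S).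
Proof.
move=> iRS; split; apply: is_line_graph_iso; first exact: PIS_iso.
exact/PIS_iso/ring_iso_sym.
Qed.

(** * Turning a ring whose zero ideal is maximal into a field *)

Section FieldOfRing.
Variables (S : comPzRingType) (maxS0 : maximal_ideal [set (0 : S)]).

(* The proof is an argument of the type, so that it carries a field instance. *)
Definition field_of_ring of maximal_ideal [set (0 : S)] : Type := S.
Local Notation F := (field_of_ring maxS0).

HB.instance Definition _ := GRing.ComPzRing.copy F S.

Fact field_of_ring_oner_neq0 : 1 != 0 :> F.
Proof. by have [_ nS1 _] := (maximal_idealP _).1 maxS0; apply/eqP. Qed.

HB.instance Definition _ :=
  GRing.PzSemiRing_isNonZero.Build F field_of_ring_oner_neq0.

(** Modulo the zero ideal, the criterion for maximality reads r x = 1 for nonzero x. Choice collects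
    these r into a function, with the conventional value 0 at 0. *)
Fact field_of_ring_inv : exists inv : F -> F,
  (forall x, x != 0 -> inv x * x = 1) /\ inv 0 = 0.
Proof.
have [_ _ invS] := (maximal_idealP _).1 maxS0.
have /choice[inv invP] (x : F) : exists y : F,
    (x != 0 -> y * x = 1) /\ (x = 0 -> y = 0).
  have [->|/eqP nx] := eqVneq x 0; first by exists 0.
  by have [r /subr0_eq/esym rx] := invS x nx; exists r.
exists inv; split; first by move=> x; case: (invP x).
by case: (invP 0) => _; apply.
Qed.

HB.instance Definition _ := GRing.ComNzRing_isField.Build F
  (projT2 (cid field_of_ring_inv)).1 (projT2 (cid field_of_ring_inv)).2.

Lemma field_of_ring_iso : exists F : fieldType, ring_iso S F.
Proof.
exists F; apply: (@ring_isoI S F (fun x : S => x : F)) => //.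
by exists (fun x : F => x : S).
Qed.

End FieldOfRing.

(** * Finite products and the case of at least three factors *)

Section ProductProjections.
Variables (n : nat) (R_ : 'I_n -> comPzRingType).
Implicit Types i j k : 'I_n.

Definition prod_proj i (f : prod_ring R_) : R_ i := f i.

Fact prod_proj_zmod_morphism i : zmod_morphism (prod_proj i).
Proof. by move=> f g; rewrite /prod_proj !ffunE. Qed.

Fact prod_proj_monoid_morphism i : monoid_morphism (prod_proj i).
Proof. by split=> [|f g]; rewrite /prod_proj !ffunE. Qed.

HB.instance Definition _ i := GRing.isZmodMorphism.Build
  (prod_ring R_) (R_ i) (prod_proj i) (prod_proj_zmod_morphism i).
HB.instance Definition _ i := GRing.isMonoidMorphism.Build
  (prod_ring R_) (R_ i) (prod_proj i) (prod_proj_monoid_morphism i).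

Definition prod_inj i (x : R_ i) : prod_ring R_ :=
  [ffun j => dfwith (fun k => 0 : R_ k) x j].

Lemma prod_projK i (x : R_ i) : prod_proj i (prod_inj x) = x.
Proof. by rewrite /prod_proj ffunE dfwith_in. Qed.

Lemma prod_proj_inj_neq i j (x : R_ i) : i != j -> prod_proj j (prod_inj x) = 0.
Proof. by move=> ij; rewrite /prod_proj ffunE dfwith_out. Qed.

Lemma prod_proj_surj i (y : R_ i) : exists f, prod_proj i f = y.
Proof. by exists (prod_inj y); apply: prod_projK. Qed.

Lemma prod_projP (f g : prod_ring R_) :
  (forall i, prod_proj i f = prod_proj i g) -> f = g.
Proof. by move=> fg; apply/ffunP => i; apply: fg. Qed.

Lemma prod_ring_iso2 i j : i != j -> (forall k, k = i \/ k = j) ->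
  ring_iso (prod_ring R_) (R_ i * R_ j)%type.
Proof.
move=> ij ijT; apply: (@ring_isoI _ _ (fun f => (prod_proj i f, prod_proj j f))).
- by move=> f g /=; rewrite !rmorphB.
- by move=> f g /=; rewrite !rmorphM.
- by rewrite !rmorph1.
apply: inj_surj_bij.
  by move=> f g [fi fj]; apply: prod_projP => k; case: (ijT k) => ->.
move=> [x y]; exists (prod_inj x + prod_inj y).
by rewrite !rmorphD /= !prod_projK !prod_proj_inj_neq ?add0r ?addr0 // eq_sym.
Qed.

Lemma prod_ring_iso3 i j k : i != j -> i != k -> j != k ->
  (forall l, [\/ l = i, l = j | l = k]) ->
  ring_iso (prod_ring R_) (R_ i * R_ j * R_ k)%type.
Proof.
move=> ij ik jk ijkT.
apply: (@ring_isoI _ _ (fun f => (prod_proj i f, prod_proj j f, prod_proj k f))).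
- by move=> f g /=; rewrite !rmorphB.
- by move=> f g /=; rewrite !rmorphM.
- by rewrite !rmorph1.
apply: inj_surj_bij.
  by move=> f g [fi fj fk]; apply: prod_projP => l; case: (ijkT l) => ->.
move=> [[x y] z]; exists (prod_inj x + prod_inj y + prod_inj z).
rewrite !rmorphD /= !prod_projK !prod_proj_inj_neq ?add0r ?addr0 //; by rewrite eq_sym.
Qed.

End ProductProjections.

(** The maximal ideals [M_ i], [M_ j], [M_ k] pulled back to the product are distinct, so their
    intersection vanishes. This forces these three factors to be fields and leaves no room for a
    fourth. *)
Lemma prod_ring_three_maximal (n : nat) (R_ : 'I_n -> comPzRingType)
    (M_ : forall i, set (R_ i)) (i j k : 'I_n) :
    (forall i, maximal_ideal (M_ i)) -> i != j -> i != k -> j != k ->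
    is_line_graph (PIS (prod_ring R_)) ->
  exists F1 F2 F3 : fieldType, ring_iso (prod_ring R_) (F1 * F2 * F3)%type.
Proof.
move=> maxM ij ik jk lG.
pose m l := prod_proj l @^-1` M_ l : set (prod_ring R_).
have maxm l : maximal_ideal (m l).
  by apply: maximal_preimage => // y; apply: prod_proj_surj.
have M0 l : M_ l 0 by have [/ideal0] := maxM l.
have nM1 l : ~ M_ l 1 by have [] := (maximal_idealP _).1 (maxM l).
have m_inj l l' : l != l' -> m l <> m l'.
  move=> nll' E; have : m l' (prod_inj (1 : R_ l)).
    by rewrite /m /preimage /= prod_proj_inj_neq.
  by rewrite -E /m /preimage /= prod_projK; apply: nM1.
have m0 := pis_claw_three_maximal (maxm i) (maxm j) (maxm k)
  (And3 (m_inj _ _ ij) (m_inj _ _ ik) (m_inj _ _ jk)) lG.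
(* Embedded in the product, such an x lies in all three pulled-back ideals. The first alternative
   yields [M_ l = [set 0]]; the second, applied to x = 1, excludes any further index. *)
have prod_inj0 l (x : R_ l) : M_ l x \/ [/\ l != i, l != j & l != k] -> x = 0.
  move=> lx; rewrite -[x]prod_projK.
  have -> : prod_inj x = 0; last by rewrite rmorph0.
  suff : (m i `&` m j `&` m k) (prod_inj x) by rewrite m0.
  have mx l' : l' = l -> M_ l x -> m l' (prod_inj x).
    by move=> -> ?; rewrite /m /preimage /= prod_projK.
  have mN l' : l != l' -> m l' (prod_inj x).
    by move=> ll'; rewrite /m /preimage /= prod_proj_inj_neq.
  case: lx => [Mx|[? ? ?]]; last by do 2?split; apply: mN.
  by do 2?split; [have [] := eqVneq l i| have [] := eqVneq l j| have [] := eqVneq l k];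
    [move=> /esym/mx; apply|apply: mN|move=> /esym/mx; apply|apply: mN
    |move=> /esym/mx; apply|apply: mN].
have fieldR l : exists F : fieldType, ring_iso (R_ l) F.
  apply: field_of_ring_iso; have <- // : M_ l = [set 0].
  apply/seteqP; split=> x; last by move=> ->.
  by move=> Mx; apply: prod_inj0; left.
have [[F1 iso1] [F2 iso2] [F3 iso3]] := And3 (fieldR i) (fieldR j) (fieldR k).
exists F1, F2, F3.
apply: (@ring_iso_trans _ (R_ i * R_ j * R_ k)%type); last first.
  by do 2!apply: ring_iso_pair => //.
apply: prod_ring_iso3 => // l.
have [->|li] := eqVneq l i; first exact: Or31.
have [->|lj] := eqVneq l j; first exact: Or32.
have [->|lk] := eqVneq l k; first exact: Or33.
by case: (nM1 l); rewrite (@prod_inj0 l 1) //; right.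
Qed.

(** * Ideals of a product of two rings and the claws found there *)

Section PairIdeals.
Variables A B : comPzRingType.
Implicit Types (I M : set A) (J N : set B).

Lemma ideal_setX I J : is_ideal I -> is_ideal J -> is_ideal (I `*` J).
Proof.
move=> iI iJ; split; first by split; apply: ideal0.
  by move=> x y [Ix Jx] [Iy Jy]; split; apply: idealD.
by move=> r x [Ix Jx]; split; apply: idealMl.
Qed.

Lemma ideal_sum_setX I I' J J' :
  ideal_sum (I `*` J) (I' `*` J') = ideal_sum I I' `*` ideal_sum J J'.
Proof.
apply/seteqP; split=> [_ [x [Ix Jx] [y [Iy Jy] <-]]|].
  by split; [exists x.1 => //; exists y.1 | exists x.2 => //; exists y.2].
move=> [_ _] [/= [x Ix [x' Ix' <-]] [y Jy [y' Jy' <-]]].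
by exists (x, y) => //; exists (x', y').
Qed.

Lemma prime_pair (P : set (A * B)) : prime_ideal P -> P (1, 0) \/ P (0, 1).
Proof.
move=> [iP _ primeP]; apply: primeP.
have -> : (1, 0) * (0, 1) = 0 :> A * B by congr pair; rewrite /= ?mulr0 ?mul0r.
exact: ideal0.
Qed.

Lemma prime_setX I J : prime_ideal (I `*` J) -> I 1 \/ J 1.
Proof. by move=> /prime_pair[[? _]|[_ ?]]; [left|right]. Qed.

Lemma maximal_setXT M : maximal_ideal M -> maximal_ideal (M `*` [set: B]).
Proof.
move=> mM; have -> : M `*` [set: B] = fst @^-1` M.
  by apply/seteqP; split=> [x []|].
by apply: maximal_preimage mM => y; exists (y, 0).
Qed.

Lemma maximal_setTX N : maximal_ideal N -> maximal_ideal ([set: A] `*` N).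
Proof.
move=> mN; have -> : [set: A] `*` N = snd @^-1` N.
  by apply/seteqP; split=> [x []|].
by apply: maximal_preimage mN => y; exists (0, y).
Qed.

Lemma vertex_setX I J : is_ideal I -> is_ideal J ->
  I <> [set 0] \/ J <> [set 0] -> ~ I 1 \/ ~ J 1 ->
  [/\ is_ideal (I `*` J), I `*` J <> [set 0] & ~ (I `*` J) 1].
Proof.
move=> iI iJ n0 n1; have iX := ideal_setX iI iJ; split=> //.
  apply/ideal_neq0P => //; case: n0 => [/ideal_neq0P|/ideal_neq0P].
    move=> /(_ iI)[x Ix nx]; exists (x, 0); last by case.
    by split=> //; apply: ideal0.
  move=> /(_ iJ)[x Jx nx]; exists (0, x); last by case.
  by split=> //; apply: ideal0.
by case=> I1 J1; case: n1.
Qed.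

Lemma setX_inj I I' J J' : is_ideal I -> is_ideal I' -> is_ideal J -> is_ideal J' ->
  I `*` J = I' `*` J' -> I = I' /\ J = J'.
Proof.
move=> iI iI' iJ iJ' E; split; apply/seteqP; split=> x Kx.
- have : (I `*` J) (x, 0) by split=> //; apply: ideal0.
  by rewrite E => -[].
- have : (I' `*` J') (x, 0) by split=> //; apply: ideal0.
  by rewrite -E => -[].
- have : (I `*` J) (0, x) by split=> //; apply: ideal0.
  by rewrite E => -[].
- have : (I' `*` J') (0, x) by split=> //; apply: ideal0.
  by rewrite -E => -[].
Qed.

Lemma setX_neq I I' J J' : is_ideal I -> is_ideal I' -> is_ideal J -> is_ideal J' ->
  I <> I' \/ J <> J' -> I `*` J <> I' `*` J'.
Proof. by move=> iI iI' iJ iJ' nIJ /(setX_inj iI iI' iJ iJ')[? ?]; case: nIJ. Qed.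

(** Every sum of the centre with a leaf is M x B, which is maximal. Every sum of two leaves is M x
    N, which contains neither (1, 0) nor (0, 1) although their product is 0. *)
Lemma pis_pair_field M N :
    maximal_ideal M -> maximal_ideal N -> is_line_graph (PIS (A * B)%type) ->
  M = [set 0] \/ N = [set 0].
Proof.
move=> mM mN lG; apply: contrapT => /not_orP[M0 N0]; move: lG.
have [iM nM1 _] := (maximal_idealP _).1 mM.
have [iN nN1 _] := (maximal_idealP _).1 mN.
have iA := @ideal_set0 A; have iB := @ideal_set0 B.
have iT := @ideal_setT B.
have sMM := ideal_sum_absorbl iM iM (fun x Mx => Mx).
have sNN := ideal_sum_absorbl iN iN (fun x Nx => Nx).
have s0M : [set 0] `<=` M by move=> _ ->; apply: ideal0.
have s0N : [set 0] `<=` N by move=> _ ->; apply: ideal0.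
have MT := maximal_prime (maximal_setXT mM).
have nMN : ~ prime_ideal (M `*` N) by move=> /prime_setX[].
have nNT : N <> setT by apply/ideal_neqT.
have nT0 : [set: B] <> [set 0].
  have [y _ ny] := (ideal_neq0P iN).1 N0.
  by move=> T0; apply: ny; have : [set: B] y by []; rewrite T0.
apply: (@pis_claw _ (M `*` [set: B]) (M `*` [set 0]) ([set 0] `*` N) (M `*` N)).
- by apply: vertex_setX => //; left.
- by apply: vertex_setX => //; left.
- by apply: vertex_setX => //; right.
- by apply: vertex_setX => //; left.
- by split; apply: setX_neq => //;
  by [left | right | left; exact/nesym | right; exact/nesym].
- by split; apply: setX_neq => //;
  by [left | right | left; exact/nesym | right; exact/nesym].
- rewrite !ideal_sum_setX sMM (ideal_sum_absorbl iA iM s0M).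
  by rewrite (ideal_sum_absorbl iB iT) // (ideal_sum_absorbl iN iT).
- rewrite !ideal_sum_setX sMM sNN (ideal_sum_absorbl iA iM s0M).
  by rewrite (ideal_sum_absorbr iA iM s0M) !(ideal_sum_absorbr iB iN s0N).
Qed.

(** The centre M x 0 gives the sums A x 0, M x B and M x B, all maximal. Two leaves add up to the
    whole ring or to I x B, which is strictly smaller than the proper ideal M x B and so not
    maximal. *)
Lemma pis_pair_minimal M I :
    artinian (A * B)%type -> maximal_ideal M -> maximal_ideal [set (0 : B)] ->
    is_line_graph (PIS (A * B)%type) -> is_ideal I -> I `<=` M ->
  I = [set 0] \/ I = M.
Proof.
move=> artAB mM m0 lG iI IM; apply: contrapT => /not_orP[I0 nIM]; move: lG.
have [iM nM1 _] := (maximal_idealP _).1 mM.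
have [iB nB1 _] := (maximal_idealP _).1 m0.
have iA := @ideal_set0 A.
have iTA := @ideal_setT A; have iTB := @ideal_setT B.
have [x Ix nx] := (ideal_neq0P iI).1 I0.
have M0 : M <> [set 0] by apply/(ideal_neq0P iM); exists x => //; apply: IM.
have nA1 : ~ [set (0 : A)] 1.
  by move=> A1; apply: nx; rewrite -[x]mul1r A1 mul0r.
have sub0 (R : comPzRingType) (K : set R) : is_ideal K -> [set 0] `<=` K.
  by move=> iK _ ->; apply: ideal0.
have nTM : [set: A] <> M by apply/nesym/(ideal_neqT iM).
have nT0 : [set: B] <> [set 0] by apply/nesym/(ideal_neqT iB).
have nTA0 : [set: A] <> [set 0] by apply/nesym/(ideal_neqT iA).
have pMT := maximal_prime (maximal_setXT mM).
have pT0 := maximal_prime (maximal_setTX m0).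
have nIT : ~ prime_ideal (I `*` [set: B]).
  move=> /(artinian_prime_maximal artAB)[iIT _ maxIT].
  have [|E|E] := maxIT _ (ideal_setX iM iTB).
  - by move=> y [Iy _]; split=> //; apply: IM.
  - by have [/esym] := setX_inj iM iI iTB iTB E.
  - by case: pMT.
have nTT : ~ prime_ideal ([set: A] `*` [set: B]).
  by case=> _ nT _; apply: nT; apply/seteqP.
apply: (@pis_claw _ (M `*` [set 0]) ([set: A] `*` [set 0]) ([set 0] `*` [set: B])
  (I `*` [set: B])).
- by apply: vertex_setX => //; left.
- by apply: vertex_setX => //; [left|right].
- by apply: vertex_setX => //; [right|left].
- by apply: vertex_setX => //; [left|left=> /IM].
- by split; apply: setX_neq => //;
  by [left | right | left; exact/nesym | right; exact/nesym].
- by split; apply: setX_neq => //;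
  by [left | right | left; exact/nesym | right; exact/nesym].
- rewrite !ideal_sum_setX; split.
  + by rewrite !ideal_sum_absorbr.
  + by rewrite ideal_sum_absorbl ?ideal_sum_absorbr //; apply: sub0.
  + by rewrite ideal_sum_absorbl ?ideal_sum_absorbr //; apply: sub0.
- rewrite !ideal_sum_setX; split.
  + by rewrite ideal_sum_absorbl ?ideal_sum_absorbr //; apply: sub0.
  + by rewrite ideal_sum_absorbl ?ideal_sum_absorbr //; apply: sub0.
  + by rewrite ideal_sum_absorbr ?ideal_sum_absorbr //; apply: sub0.
Qed.

End PairIdeals.

(** * Local rings whose maximal ideal is minimal *)

(* A minimal nonzero ideal aS is isomorphic to S / Ann(a), so Ann(a) is maximal;
   in a local ring whose maximal ideal M is aS this gives Ann(a) = M. *)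
Lemma local_minimal_maximal (S : comPzRingType) (M : set S) :
    local_with_maximal S M -> M <> [set 0] ->
    (forall I, is_ideal I -> I `<=` M -> I = [set 0] \/ I = M) ->
  principal_ideal_ring S /\ nilpotent_index M 2.
Proof.
move=> [mM uniqM] M0 minM; have [iM nM1 invM] := (maximal_idealP _).1 mM.
have generates x : M x -> x <> 0 -> M = [set y * x | y in [set: S]].
  move=> Mx nx; have [|E|//] := minM _ (ideal_principal x).
  - by move=> _ [y _ <-]; apply: idealMl.
  - have : [set y * x | y in [set: S]] x by exists 1; rewrite ?mul1r.
    by rewrite E.
have [a Ma na] := (ideal_neq0P iM).1 M0; have Ea := generates a Ma na.
have annM : M = [set y | y * a = 0].
  apply: uniqM; apply/maximal_idealP; split.
  - split=> /= [|x y|r x]; first exact: mul0r.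
    + by rewrite mulrDl => -> ->; rewrite addr0.
    + by rewrite -mulrA => ->; rewrite mulr0.
  - by rewrite /= mul1r.
  (* If x a is nonzero it generates M as well, so a = r x a and 1 - r x annihilates a. *)
  - move=> x /= nxa; have : M a by [].
    rewrite {1}(generates (x * a)) //; last exact: idealMl.
    by move=> [r _ E]; exists r; rewrite mulrBl mul1r -mulrA E subrr.
have MM0 x y : M x -> M y -> x * y = 0.
  rewrite {2}Ea => Mx [r _ <-]; rewrite mulrCA.
  by move: Mx; rewrite annM /= => ->; rewrite mulr0.
split.
  move=> I iI; have [IM|nIM] := EM (I `<=` M).
    have [->|->] := minM I iI IM; last by exists a.
    exists 0; apply/seteqP; split=> [_ ->|_ [y _ <-]]; last by rewrite mulr0.
    by exists 1; rewrite ?mul1r.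
  have [x Ix nMx] : exists2 x, I x & ~ M x.
    by apply: contrapT => h; apply: nIM => x Ix; apply: contrapT => ?; apply: h; exists x.
  have [r Mr] := invM x nMx.
  exists 1; rewrite (ideal_eqT iI); last first.
    (* The last summand is the square of an element of M, hence 0; what remains is a multiple of
       x. *)
    have -> : 1 = (2%:R - r * x) * r * x + (1 - r * x) * (1 - r * x) by ring.
    by rewrite (MM0 _ _ Mr Mr) addr0; apply: idealMl.
  by apply/seteqP; split=> // y _; exists y => //; rewrite mulr1.
split=> //.
  apply/seteqP; split=> [x [k [b [c [Mb [Mc ->]]]]] | _ ->].
    apply: big1 => i _; apply: MM0 => //.
    (* [ideal_pow M 2] unfolds to M (M S), so the second factor is itself a sum that has to be
       brought back into M. *)
    have [l [d [e [Md [_ ->]]]]] := Mc i.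
    elim/big_rec: _ => [|j y _ My]; first exact: ideal0.
    by apply: idealD => //; apply: idealMr.
  exists 0, (fun=> 0), (fun=> 0); rewrite big_ord0.
  by do !split; case.
(* Only exponent 1 needs an argument: [ideal_pow M 1] contains a * 1, which is nonzero. *)
case=> [//|[_ E|//]]; exfalso; apply: na.
have : ideal_pow M 1 (a * 1) by apply: mem_ideal_prod.
by rewrite E mulr1.
Qed.

(** * Rings whose ideals are coded by three bits, and the 3-sun *)

Section ThreeGenerators.
Implicit Types b c : bool * bool * bool.

Definition or_bits b c := (b.1.1 || c.1.1, b.1.2 || c.1.2, b.2 || c.2).

Definition two_bits b := (b.1.1 + b.1.2 + b.2 == 2)%N.

(* The net: the triangle 0 1 2 with a pendant edge at each of its vertices. Its
   line graph is the 3-sun, whose vertices are here the bit triples other than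
   000 and 111, adjacent when their disjunction has exactly two bits. *)
Definition net_edge b : nat * nat :=
  match b with
  | (true, false, false) => (0, 1)
  | (false, true, false) => (1, 2)
  | (false, false, true) => (0, 2)
  | (true, true, false) => (1, 4)
  | (false, true, true) => (2, 5)
  | _ => (0, 3)
  end%N.

(** Only the zero ideal can have bits 000, and only the whole ring 111. On both triples [net_edge]
    falls into its default case, whose value is the edge of 101, so injectivity requires leaving
    them out. *)
Definition nontrivial_bits b :=
  (b != (false, false, false)) && (b != (true, true, true)).

Lemma net_edge_neq b : (net_edge b).1 <> (net_edge b).2.
Proof. by case: b => [[[] []] []]. Qed.

Lemma net_edge_inj b c : nontrivial_bits b -> nontrivial_bits c ->
  [set (net_edge b).1; (net_edge b).2] = [set (net_edge c).1; (net_edge c).2] ->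
  b = c.
Proof.
move=> nb nc E.
have : [set (net_edge c).1; (net_edge c).2] (net_edge b).1 by rewrite -E; left.
have : [set (net_edge c).1; (net_edge c).2] (net_edge b).2 by rewrite -E; right.
move: nb nc {E}; case: b => [[[] []] []]; case: c => [[[] []] []] // _ _;
  move=> [] // _ [] //.
Qed.

Lemma net_edge_meet b c : nontrivial_bits b -> nontrivial_bits c -> b <> c ->
  two_bits (or_bits b c) <->
  [set (net_edge b).1; (net_edge b).2] `&`
    [set (net_edge c).1; (net_edge c).2] !=set0.
Proof.
move=> nb nc nbc; split.
  move: nb nc nbc; case: b => [[[] []] []]; case: c => [[[] []] []] // _ _ _ _ /=;
  (* Only the triangle vertices 0, 1, 2 can be common ends: the pendant ends 3, 4, 5 lie on one edge
     each. *)
  by [exists 0%N; split; [left|left] | exists 0%N; split; [left|right]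
     | exists 0%N; split; [right|left] | exists 1%N; split; [left|left]
     | exists 1%N; split; [left|right] | exists 1%N; split; [right|left]
     | exists 2%N; split; [left|left] | exists 2%N; split; [left|right]
     | exists 2%N; split; [right|left] | exists 2%N; split; [right|right]].
move=> [x [bx cx]]; move: nb nc nbc bx cx.
by case: b => [[[] []] []]; case: c => [[[] []] []] // _ _ _ /= [->|->] [].
Qed.

(* An ideal is determined by which of t1, t2, t3 it contains: x lies in I when each
   t_i is in I or not needed for x, the latter meaning z_i x. The prime ideals are
   those containing exactly two of them. For F1 * F2 the third element is t3 = 0,
   with z3 = setT; for S * F the triple is (a, 0), (1, 0), (0, 1), where a
   generates the maximal ideal of S. *)
Variables (R : comPzRingType) (t1 t2 t3 : R) (z1 z2 z3 : set R).

Definition ideal_bits (I : set R) := (`[<I t1>], `[<I t2>], `[<I t3>]).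

Hypothesis idealE : forall I, is_ideal I -> forall x,
  I x <-> [/\ z1 x \/ I t1, z2 x \/ I t2 & z3 x \/ I t3].
Hypotheses (z1D : forall x y, z1 x -> z1 y -> z1 (x + y))
           (z2D : forall x y, z2 x -> z2 y -> z2 (x + y))
           (z3D : forall x y, z3 x -> z3 y -> z3 (x + y)).
Hypotheses (z1t : z1 t1 -> t1 = 0) (z2t : z2 t2 -> t2 = 0) (z3t : z3 t3 -> t3 = 0).
Hypotheses (prime12 : forall P, prime_ideal P -> P t1 \/ P t2)
           (prime13 : forall P, prime_ideal P -> P t1 \/ P t3)
           (prime23 : forall P, prime_ideal P -> P t2 \/ P t3).
Hypotheses
  (prime_z1 : forall I, is_ideal I -> ~ I t1 -> I t2 -> I t3 ->
     forall x y, z1 (x * y) -> z1 x \/ z1 y)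
  (prime_z2 : forall I, is_ideal I -> I t1 -> ~ I t2 -> I t3 ->
     forall x y, z2 (x * y) -> z2 x \/ z2 y)
  (prime_z3 : forall I, is_ideal I -> I t1 -> I t2 -> ~ I t3 ->
     forall x y, z3 (x * y) -> z3 x \/ z3 y).

(** A prime misses at most one of the three elements, and containing all three would make it the
    whole ring by [idealE]. Conversely, if only the i-th is missing, [idealE] reduces membership in
    P to the i-th predicate z, which is then prime. *)
Lemma prime_two_bits P : is_ideal P -> prime_ideal P <-> two_bits (ideal_bits P).
Proof.
move=> iP; split=> [pP | ].
  have [_ /(ideal_neqT iP) nP1 _] := pP.
  have n123 : ~ (P t1 /\ P t2 /\ P t3).
    by move=> [P1 [P2 P3]]; apply: nP1; apply/(idealE iP); split; right.
  move: (prime12 pP) (prime13 pP) (prime23 pP); rewrite /ideal_bits /two_bits /=.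
  case: (asboolP (P t1)); case: (asboolP (P t2)); case: (asboolP (P t3)) => //;
    move=> ? ? ? ? ? ?; exfalso; tauto.
have nP1 : ~ [/\ P t1, P t2 & P t3] -> P <> setT.
  by move=> n123 PT; apply: n123; rewrite PT.
rewrite /ideal_bits /two_bits /=.
case: (asboolP (P t1)); case: (asboolP (P t2)); case: (asboolP (P t3)) => //
  P3 P2 P1 _; split=> //; try (by apply: nP1; case).
- move=> x y /(idealE iP)[_ _ []// /(prime_z3 iP P1 P2 P3)[z|z]];
    by [left; apply/(idealE iP); split; [right|right|left]
       |right; apply/(idealE iP); split; [right|right|left]].
- move=> x y /(idealE iP)[_ []// /(prime_z2 iP P1 P2 P3)[z|z] _];
    by [left; apply/(idealE iP); split; [right|left|right]
       |right; apply/(idealE iP); split; [right|left|right]].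
- move=> x y /(idealE iP)[[]// /(prime_z1 iP P1 P2 P3)[z|z] _ _];
    by [left; apply/(idealE iP); split; [left|right|right]
       |right; apply/(idealE iP); split; [left|right|right]].
Qed.

Lemma ideal_bits_inj I J : is_ideal I -> is_ideal J ->
  ideal_bits I = ideal_bits J -> I = J.
Proof.
move=> iI iJ [e1 e2 e3]; apply/seteqP.
have E1 := propext (asbool_eq_equiv e1).
have E2 := propext (asbool_eq_equiv e2).
have E3 := propext (asbool_eq_equiv e3).
by split=> x; rewrite (idealE iI x) (idealE iJ x) E1 E2 E3.
Qed.

(** Suppose t = x + y with x in I and y in J, and t in neither ideal. Then z holds of x and of y,
    hence of t, so t = 0, which every ideal contains. *)
Lemma ideal_bits_sum I J : is_ideal I -> is_ideal J ->
  ideal_bits (ideal_sum I J) = or_bits (ideal_bits I) (ideal_bits J).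
Proof.
move=> iI iJ.
have sum_t (z : set R) t : (forall x y, z x -> z y -> z (x + y)) -> (z t -> t = 0) ->
    (forall K, is_ideal K -> forall x, K x -> z x \/ K t) ->
    `[<ideal_sum I J t>] = `[<I t>] || `[<J t>].
  move=> zD zt zK; rewrite -asbool_or; apply: asbool_equiv_eq; split.
    move=> [x Ix [y Jy xy]].
    have [zx|] := zK I iI x Ix; [|by left].
    have [zy|] := zK J iJ y Jy; [|by right].
    left; rewrite zt; first exact: ideal0.
    by rewrite -xy; apply: zD.
  by case=> [/(ideal_sum_subl iJ)|/(ideal_sum_subr iI)].
rewrite /ideal_bits /or_bits /=; congr (_, _, _).
- by apply: (sum_t z1) => // K iK x /(idealE iK)[].
- by apply: (sum_t z2) => // K iK x /(idealE iK)[].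
- by apply: (sum_t z3) => // K iK x /(idealE iK)[].
Qed.

Lemma vertex_nontrivial_bits (v : PIS R) : nontrivial_bits (ideal_bits (sval v)).
Proof.
case: v => I [iI nI0 nIT] /=; apply/andP; split; apply/eqP=> E.
  apply: nI0; apply: ideal_bits_inj => //; first exact: ideal_set0.
  rewrite E; case: E => /asboolPn h1 /asboolPn h2 /asboolPn h3.
  (* Since I contains 0, an element outside I is nonzero; hence the zero ideal also has bits 000. *)
  have n0 t : ~ I t -> `[<[set 0] t>] = false.
    by move=> nIt; apply/asboolPn => /= t0; apply: nIt; rewrite t0; apply: ideal0.
  by rewrite /ideal_bits !n0.
apply: nIT; apply: ideal_bits_inj => //; rewrite E /ideal_bits.
by congr (_, _, _); apply/esym/asboolT.
Qed.

(** The bits embed the graph into the 3-sun as an induced subgraph; keeping only the net edges that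
    occur gives the root graph. *)
Lemma pis_line_graph_three : is_line_graph (PIS R).
Proof.
have bits_inj (u v : PIS R) : ideal_bits (sval u) = ideal_bits (sval v) -> u = v.
  case: u v => I vI [J vJ] /= E; apply: eq_exist.
  by apply: ideal_bits_inj => //; [case: vI | case: vJ].
pose e (v : PIS R) := net_edge (ideal_bits (sval v)).
apply: (@is_line_graph_endpoints _ nat (fun v => (e v).1) (fun v => (e v).2)).
- by move=> v; apply: net_edge_neq.
- move=> u v /net_edge_inj E; apply: bits_inj.
  by apply: E; apply: vertex_nontrivial_bits.
- move=> u v; have [iu _ _] := svalP u; have [iv _ _] := svalP v.
  rewrite /= /pis_adj prime_two_bits; last exact: ideal_ideal_sum.
  rewrite ideal_bits_sum //.
  have meet := net_edge_meet (vertex_nontrivial_bits u) (vertex_nontrivial_bits v).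
  by split=> -[nuv h]; split=> //; move: h; apply meet => /bits_inj.
Qed.

End ThreeGenerators.

(** * The three listed families of rings *)

Lemma ideal_pairE (A B : comPzRingType) (I : set (A * B)) x : is_ideal I ->
  I x <-> I (x.1, 0) /\ I (0, x.2).
Proof.
move=> iI; split=> [Ix|[I1 I2]]; last first.
  have -> : x = (x.1, 0) + (0, x.2) :> A * B; last exact: idealD.
  by case: x {I1 I2} => u v; congr pair; rewrite /= ?addr0 ?add0r.
split.
  have -> : (x.1, 0) = (1, 0) * x :> A * B; last exact: idealMl.
  by congr pair; rewrite /= ?mul1r ?mul0r.
have -> : (0, x.2) = (0, 1) * x :> A * B; last exact: idealMl.
by congr pair; rewrite /= ?mul1r ?mul0r.
Qed.

(** Here [h] is the embedding of a field as one factor of a product: multiplying by the inverse of a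
    nonzero u carries [h u] to [h 1]. A general [h] covers both factors at once. *)
Lemma ideal_field_multiples (A : comPzRingType) (F : fieldType) (I : set A)
    (h : F -> A) u :
    is_ideal I -> h 0 = 0 -> (forall x y : F, exists r, h (x * y) = r * h y) ->
  I (h u) <-> u = 0 \/ I (h 1).
Proof.
move=> iI h0 hM; split=> [Iu|[->|I1]]; last first.
- by have [r] := hM u 1; rewrite mulr1 => ->; apply: idealMl.
- by rewrite h0; apply: ideal0.
have [->|nu] := eqVneq u 0; [by left|right].
by have [r] := hM u^-1 u; rewrite mulVf // => ->; apply: idealMl.
Qed.

Lemma ideal_inl_field (F : fieldType) (B : comPzRingType) (I : set (F * B)) u :
  is_ideal I -> I (u, 0) <-> u = 0 \/ I (1, 0).
Proof.
move=> iI; apply: (ideal_field_multiples (h := fun x : F => (x, 0 : B))) => // x y.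
by exists (x, 0); congr pair; rewrite /= ?mulr0.
Qed.

Lemma ideal_inr_field (A : comPzRingType) (F : fieldType) (I : set (A * F)) u :
  is_ideal I -> I (0, u) <-> u = 0 \/ I (0, 1).
Proof.
move=> iI; apply: (ideal_field_multiples (h := fun x : F => (0 : A, x))) => // x y.
by exists (0, x); congr pair; rewrite /= ?mulr0.
Qed.

Lemma field_mul_eq0 (F : fieldType) (x y : F) : x * y = 0 -> x = 0 \/ y = 0.
Proof. by move=> /eqP; rewrite mulf_eq0 => /orP[] /eqP; [left|right]. Qed.

Lemma prime_mul0 (R : comPzRingType) (P : set R) x y :
  x * y = 0 -> prime_ideal P -> P x \/ P y.
Proof. by move=> xy [iP _ primeP]; apply: primeP; rewrite xy; apply: ideal0. Qed.

Lemma pis_two_fields (F1 F2 : fieldType) : is_line_graph (PIS (F1 * F2)%type).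
Proof.
apply: (@pis_line_graph_three _ (1, 0) (0, 1) 0
  [set x | x.1 = 0] [set x | x.2 = 0] setT) => //=.
- move=> I iI x; rewrite (ideal_pairE x iI) ideal_inl_field // ideal_inr_field //.
  by split=> [[? ?]|[? ? _]]; split=> //; left.
- by move=> x y /= -> ->; rewrite addr0.
- by move=> x y /= -> ->; rewrite addr0.
- by move=> /= /eqP; rewrite oner_eq0.
- by move=> /= /eqP; rewrite oner_eq0.
- by move=> P; apply: prime_pair.
(* The third element is 0, so the third bit is always set. *)
- by move=> P [/ideal0 P0 _ _]; right.
- by move=> P [/ideal0 P0 _ _]; right.
- by move=> I _ _ _ _ x y /=; apply: field_mul_eq0.
- by move=> I _ _ _ _ x y /=; apply: field_mul_eq0.
- by move=> *; left.
Qed.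

Lemma pis_three_fields (F1 F2 F3 : fieldType) :
  is_line_graph (PIS (F1 * F2 * F3)%type).
Proof.
apply: (@pis_line_graph_three _ (1, 0, 0) (0, 1, 0) (0, 0, 1)
  [set x | x.1.1 = 0] [set x | x.1.2 = 0] [set x | x.2 = 0]) => //=.
- move=> I iI x; rewrite (ideal_pairE x iI) ideal_inr_field //.
  (* The slice of I over the first two factors, so that the splitting of ideals of a pair can be
     applied a second time. *)
  pose J := [set u | I (u, 0)] : set (F1 * F2).
  have iJ : is_ideal J.
    split; first exact: (ideal0 iI).
      move=> u v Iu Iv; rewrite /J /=.
      have -> : (u + v, 0) = (u, 0) + (v, 0) :> F1 * F2 * F3; last exact: idealD.
      by congr pair; rewrite /= addr0.
    move=> r u Iu; rewrite /J /=.
    have -> : (r * u, 0) = (r, 0) * (u, 0) :> F1 * F2 * F3; last exact: idealMl.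
    by congr pair; rewrite /= mulr0.
  have := ideal_pairE x.1 iJ; rewrite ideal_inl_field // ideal_inr_field // => xJ.
  split=> [[/xJ[? ?] ?]|[? ? ?]] //; split=> //.
  by apply/xJ.
- by move=> x y /= -> ->; rewrite addr0.
- by move=> x y /= -> ->; rewrite addr0.
- by move=> x y /= -> ->; rewrite addr0.
- by move=> /= /eqP; rewrite oner_eq0.
- by move=> /= /eqP; rewrite oner_eq0.
- by move=> /= /eqP; rewrite oner_eq0.
- by move=> P; apply: prime_mul0; do 2?congr pair; rewrite /= ?mulr0 ?mul0r.
- by move=> P; apply: prime_mul0; do 2?congr pair; rewrite /= ?mulr0 ?mul0r.
- by move=> P; apply: prime_mul0; do 2?congr pair; rewrite /= ?mulr0 ?mul0r.
- by move=> I _ _ _ _ x y /=; apply: field_mul_eq0.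
- by move=> I _ _ _ _ x y /=; apply: field_mul_eq0.
- by move=> I _ _ _ _ x y /=; apply: field_mul_eq0.
Qed.

Lemma pis_local_field (S : comPzRingType) (F : fieldType) (N : set S) :
    maximal_ideal N -> principal_ideal_ring S -> nilpotent_index N 2 ->
  is_line_graph (PIS (S * F)%type).
Proof.
move=> mN pirS [_ N2 minN].
have [iN nN1 invN] := (maximal_idealP _).1 mN.
have NN0 x y : N x -> N y -> x * y = 0.
  move=> Nx Ny; have : ideal_pow N 2 (x * (y * 1)) by do 2!apply: mem_ideal_prod => //.
  by rewrite N2 mulr1.
have unitN x : ~ N x -> exists r, r * x = 1.
  (* With u = 1 - r x and u^2 = 0, the inverse of r x = 1 - u is 1 + u = 2 - r x. *)
  move=> /invN[r Nr]; exists ((2%:R - r * x) * r).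
  have -> : (2%:R - r * x) * r * x = 1 - (1 - r * x) * (1 - r * x) by ring.
  by rewrite (NN0 _ _ Nr Nr) subr0.
have [a Na] := pirS N iN.
have Naa : N a by rewrite Na; exists 1; rewrite ?mul1r.
have na : a <> 0.
  (* If a = 0 then N = 0, and the nilpotent index would be 1 instead of 2. *)
  move=> a0; have /minN-/(_ isT) // : ideal_pow N 1 = [set 0].
  have N0 : N = [set 0].
    rewrite Na a0; apply/seteqP; split=> [_ [r _ <-]|_ ->]; first by rewrite /= mulr0.
    by exists 0; rewrite ?mul0r.
  apply/seteqP; split=> [_ [k [b [c [Nb [_ ->]]]]]|_ ->].
    by apply: big1 => i _; have := Nb i; rewrite N0 /= => ->; rewrite mul0r.
  by exists 0, (fun=> 0), (fun=> 0); rewrite big_ord0; do !split; case.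
have primeN := maximal_prime mN.
apply: (@pis_line_graph_three _ (a, 0) (1, 0) (0, 1)
  [set x | x.1 = 0] [set x | N x.1] [set x | x.2 = 0]) => //=.
(* An element of S is a unit or of the form r a; in the latter case it is 0 for r in N and an
   associate of a for r a unit. *)
- move=> I iI x; rewrite (ideal_pairE x iI) ideal_inr_field //.
  have mulI r u : I (u, 0) -> I (r * u, 0).
    have -> : (r * u, 0) = (r, 0) * (u, 0) :> S * F; last exact: idealMl.
    by congr pair; rewrite /= mulr0.
  have I_a r : ~ N r -> I (r * a, 0) -> I (a, 0).
    by move=> /unitN[s sr] /(mulI s); rewrite mulrA sr mul1r.
  split=> [[I1 I2]|[I1 I2 I3]]; split=> //.
  + have [Nx|/unitN[r rx]] := EM (N x.1).
      move: I1; move: (Nx); rewrite {1}Na => -[r _ <-] I1.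
      have [Nr|nNr] := EM (N r); first by left; apply: NN0.
      by right; apply: I_a I1.
    by right; rewrite -[a]mulr1 -rx; apply: (mulI a); apply: mulI.
  + have [Nx|/unitN[r rx]] := EM (N x.1); first by left.
    by right; rewrite -rx; apply: mulI.
  + case: I2 => [|I10]; last by rewrite -[x.1]mulr1; apply: mulI.
    case: I1 => [->|Ia]; first by move=> _; apply: (ideal0 iI).
    by rewrite Na => -[r _ <-]; apply: mulI.
- by move=> x y /= -> ->; rewrite addr0.
- by move=> x y; apply: idealD.
- by move=> x y /= -> ->; rewrite addr0.
- by move=> /= /eqP; rewrite oner_eq0.
(* The square of (a, 0) is 0, so every prime contains (a, 0). *)
- move=> P pP; left; have aa : (a, 0) * (a, 0) = 0 :> S * F.
    by congr pair; rewrite /= ?mulr0 //; apply: NN0.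
  by case: (prime_mul0 aa pP).
- move=> P pP; left; have aa : (a, 0) * (a, 0) = 0 :> S * F.
    by congr pair; rewrite /= ?mulr0 //; apply: NN0.
  by case: (prime_mul0 aa pP).
- by move=> P; apply: prime_pair.
(* An ideal containing (1, 0) contains (a, 0), so the first element is never the only one
   missing. *)
- move=> I iI nI1 I2; case: nI1.
  have -> : (a, 0) = (a, 0) * (1, 0) :> S * F; last exact: idealMl.
  by congr pair; rewrite /= ?mulr1 ?mulr0.
- by move=> I _ _ _ _ x y; case: primeN => _ _; apply.
- by move=> I _ _ _ _ x y /=; apply: field_mul_eq0.
Qed.

(** * Two local factors, and the classification *)

Lemma pis_pair_local (A B : comPzRingType) (M : set A) (N : set B) :
    local_with_maximal A M -> maximal_ideal N -> N = [set 0] ->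
    artinian (A * B)%type -> is_line_graph (PIS (A * B)%type) ->
  (exists F1 F2 : fieldType, ring_iso (A * B)%type (F1 * F2)%type) \/
  (exists (S : comPzRingType) (F : fieldType) (N : set S),
        [/\ local_with_maximal S N,
            principal_ideal_ring S,
            nilpotent_index N 2
          & ring_iso (A * B)%type (S * F)%type]).
Proof.
move=> lM mN N0 artAB lG; have [mM _] := lM; rewrite N0 in mN.
have [F isoF] := field_of_ring_iso mN.
have [M0|nM0] := EM (M = [set 0]).
  left; rewrite M0 in mM; have [F' isoF'] := field_of_ring_iso mM.
  by exists F', F; apply: ring_iso_pair.
have [pir nil] := local_minimal_maximal lM nM0
  (fun I iI IM => pis_pair_minimal artAB mM mN lG iI IM).
right; exists A, F, M; split=> //; apply: ring_iso_pair => //.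
by exists idfun; exists idfun.
Qed.

Theorem theorem2p3 (R : comPzRingType) (n : nat)
    (R_ : 'I_n -> comPzRingType) (M_ : forall i : 'I_n, set (R_ i))
    (hn : (2 <= n)%N)
    (hnonlocal : ~ local_ring R)
    (hartin : artinian R)
    (hlocal : forall i : 'I_n, local_with_maximal (R_ i) (M_ i))
    (hR : ring_iso R (prod_ring R_)) :
  is_line_graph (PIS R) <->
  [\/ exists F1 F2 F3 : fieldType, ring_iso R (F1 * F2 * F3)%type,
      exists F1 F2 : fieldType, ring_iso R (F1 * F2)%type
    | exists (S : comPzRingType) (F : fieldType) (N : set S),
        [/\ local_with_maximal S N,
            principal_ideal_ring S,
            nilpotent_index N 2
          & ring_iso R (S * F)%type]].
Proof.
split; last first.
  case=> [[F1 [F2 [F3 iso]]]|[F1 [F2 iso]]|[S [F [N [[mN _] pir nil iso]]]]];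
    apply/(PIS_is_line_graph_iso iso).
  - exact: pis_three_fields.
  - exact: pis_two_fields.
  - exact: pis_local_field mN pir nil.
move=> lG.
have maxM i : maximal_ideal (M_ i) by case: (hlocal i).
pose i0 : 'I_n := Ordinal (ltnW hn); pose i1 : 'I_n := Ordinal hn.
have [n3|n2] := ltnP 2 n.
  have [//|//|//||F1 [F2 [F3 iso]]] :=
    @prod_ring_three_maximal n R_ M_ i0 i1 (Ordinal n3) maxM.
    exact: (PIS_is_line_graph_iso hR).1 lG.
  by apply: Or31; exists F1, F2, F3; apply: ring_iso_trans iso.
have iso01 : ring_iso R (R_ i0 * R_ i1)%type.
  apply: ring_iso_trans hR _; apply: prod_ring_iso2 => // k.
  case: k => [[|[|k]] kn]; [by left; apply: val_inj|by right; apply: val_inj|].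
  by have := leq_trans kn n2.
(* Either factor may turn out to be the field, while [finish] expects it in second place; the swap
   serves the other order. *)
have iso10 := ring_iso_trans iso01 (ring_iso_swap _ _).
have finish (A B : comPzRingType) (M : set A) (N : set B) :
    local_with_maximal A M -> maximal_ideal N -> N = [set 0] ->
    ring_iso R (A * B)%type ->
  [\/ exists F1 F2 F3 : fieldType, ring_iso R (F1 * F2 * F3)%type,
      exists F1 F2 : fieldType, ring_iso R (F1 * F2)%type
    | exists (S : comPzRingType) (F : fieldType) (N : set S),
        [/\ local_with_maximal S N,
            principal_ideal_ring S,
            nilpotent_index N 2
          & ring_iso R (S * F)%type]].
  move=> lM mN N0 iso; have lGAB := (PIS_is_line_graph_iso iso).1 lG.
  have [[F1 [F2 iso']]|[S [F [N' [lN pir nil iso']]]]] :=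
      pis_pair_local lM mN N0 (artinian_iso iso hartin) lGAB.
    by apply: Or32; exists F1, F2; apply: ring_iso_trans iso'.
  by apply: Or33; exists S, F, N'; split=> //; apply: ring_iso_trans iso'.
have [M0|M0] := pis_pair_field (maxM i0) (maxM i1)
  ((PIS_is_line_graph_iso iso01).1 lG).
  exact: finish (hlocal i1) (maxM i0) M0 iso10.
exact: finish (hlocal i0) (maxM i1) M0 iso01.
Qed.
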